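(* Let $J=\mathrm{diag}(1,1,-1,-1)$. Then every cyclic $J$-Jacobi method for pairs $(A,J)$, with $A$ a real symmetric positive definite $4\times 4$ matrix, is globally convergent. That is, for every ordering $\mathcal{O}$ of $\mathbf{P}_4=\{(r,s)\mid 1\le r<s\le4\}$ and every real symmetric positive definite $4\times4$ matrix $A$, the sequence of matrices $(A^{(k)},k\ge0)$ generated from $A^{(0)}=A$ by the $J$-Jacobi method under the cyclic pivot strategy $I_{\mathcal{O}}$ converges to some diagonal matrix.
   Context: Orderings and cyclic strategies: an ordering $\mathcal{O}=(i_0,j_0),\ldots,(i_5,j_5)$ of $\mathbf{P}_4$ is a listing of all six elements of $\mathbf{P}_4$, each exactly once. The cyclic pivot strategy $I_{\mathcal{O}}$ is given by $I_{\mathcal{O}}(k)=(i_{\tau(k)},j_{\tau(k)})$, where $0\le\tau(k)\le 5$ and $k\equiv\tau(k)\pmod 6$, $k\ge0$. $J$-Jacobi method (for the generalized eigenvalue problem $Ax=\lambda Jx$): with $J=\mathrm{diag}(1,1,-1,-1)$ it is the iteration $A^{(k+1)}=F_k^TA^{(k)}F_k$, $k\ge0$, $A^{(0)}=A$, where $A$ is symmetric positive definite and each $F_k$ is $J$-orthogonal, i.e. $F_k^TJF_k=J$. The matrix $F_k$ differs from the identity only in the rows and columns $i,j$, where $(i,j)=I_{\mathcal{O}}(k)$ is the pivot pair, and it is chosen so that the pivot element is annihilated, $a^{(k+1)}_{ij}=0$, where $A^{(k)}=(a^{(k)}_{rs})$. Precisely: - Trigonometric step, when the $i$-th and $j$-th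 diagonal entries of $J$ are equal, i.e. $(i,j)\in\{(1,2),(3,4)\}$: the $(i,i)$ and $(j,j)$ entries of $F_k$ are $\cos\phi_k$, the $(i,j)$ entry is $-\sin\phi_k$, the $(j,i)$ entry is $\sin\phi_k$, with $\phi_k\in[-\frac{\pi}{4},\frac{\pi}{4}]$ and $\tan(2\phi_k)=2a_{ij}^{(k)}/(a_{ii}^{(k)}-a_{jj}^{(k)})$ (with $\phi_k=0$ if $a_{ij}^{(k)}=0$, and $\phi_k\in\{\frac{\pi}{4},-\frac{\pi}{4}\}$ if $a_{ii}^{(k)}=a_{jj}^{(k)}$, $a_{ij}^{(k)}\ne0$). - Hyperbolic step, when the $i$-th and $j$-th diagonal entries of $J$ have opposite signs, i.e. $(i,j)\in\{(1,3),(1,4),(2,3),(2,4)\}$: the $(i,i)$ and $(j,j)$ entries of $F_k$ are $\cosh\theta_k$ and the $(i,j)$ and $(j,i)$ entries are $\sinh\theta_k$, with $\theta_k\in\mathbb{R}$ determined by $\tanh(2\theta_k)=-2a_{ij}^{(k)}/(a_{ii}^{(k)}+a_{jj}^{(k)})$ (well defined because $A^{(k)}$ is positive definite). *)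

(* Defs.v *)
From HB Require Import structures.
From mathcomp Require Import all_boot all_order all_algebra.
From mathcomp Require Import all_classical all_reals all_analysis.

Set Implicit Arguments.
Unset Strict Implicit.
Unset Printing Implicit Defensive.

Import Order.TTheory GRing.Theory Num.Theory.
Import numFieldNormedType.Exports.

Local Open Scope ring_scope.
Local Open Scope classical_set_scope.

(* Indices are shifted by one: 'I_4 = {0,1,2,3} stands for {1,2,3,4}. *)
Definition P4 : {set 'I_4 * 'I_4} := [set p : 'I_4 * 'I_4 | (p.1 < p.2)%N]%SET.

Definition is_ordering (O : 6.-tuple ('I_4 * 'I_4)) : bool :=
  perm_eq O (enum P4).

Definition cyclic_strategy (O : 6.-tuple ('I_4 * 'I_4)) (k : nat) : 'I_4 * 'I_4 :=
  tnth O (Ordinal (ltn_pmod k (isT : (0 < 6)%N))).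

Section JJacobi.
Context {R : realType}.
Implicit Types (A F J : 'M[R]_4) (i j : 'I_4) (x : R).

Definition J4 : 'M[R]_4 :=
  diag_mx (\row_(i < 4) (if (i < 2)%N then 1 else -1)).

Definition sym_posdef A : Prop :=
  A \is symmetricmx /\
  forall x : 'cV[R]_4, x != 0 -> 0 < (x^T *m A *m x) 0 0.

Definition cosh x : R := (expR x + expR (- x)) / 2.
Definition sinh x : R := (expR x - expR (- x)) / 2.
Definition tanh x : R := sinh x / cosh x.

(* The identity, except that its (i,j)-plane block is [[fii, fij], [fji, fjj]]. *)
Definition plane_mx i j (fii fij fji fjj : R) : 'M[R]_4 :=
  \matrix_(r, s)
    if (r == i) && (s == i) then fii
    else if (r == i) && (s == j) then fij
    else if (r == j) && (s == i) then fji
    else if (r == j) && (s == j) then fjj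
    else (r == s)%:R.

(* When A i i = A j j and A i j <> 0, either sign of the angle is allowed. *)
Definition trig_angle A i j (phi : R) : Prop :=
  - (pi / 4) <= phi <= pi / 4 /\
  (if A i j == 0 then phi = 0
   else if A i i == A j j then phi = pi / 4 \/ phi = - (pi / 4)
   else tan (2 * phi) = 2 * A i j / (A i i - A j j)).

Definition trig_step A i j F : Prop :=
  exists2 phi : R, trig_angle A i j phi
    & F = plane_mx i j (cos phi) (- sin phi) (sin phi) (cos phi).

Definition hyp_step A i j F : Prop :=
  exists2 theta : R, tanh (2 * theta) = - (2 * A i j) / (A i i + A j j)
    & F = plane_mx i j (cosh theta) (sinh theta) (sinh theta) (cosh theta).

(* J is meant to be a diagonal matrix of signs, so J i i <> J j j means that
   the two signs are opposite. *)
Definition J_jacobi_step J A i j F : Prop :=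
  if J i i == J j j then trig_step A i j F else hyp_step A i j F.

(* A relation rather than a function, because of the freedom in trig_angle. *)
Definition J_jacobi_sequence J (I : nat -> 'I_4 * 'I_4) A
    (A_ : nat -> 'M[R]_4) : Prop :=
  A_ 0%N = A /\
  exists F_ : nat -> 'M[R]_4, forall k : nat,
    J_jacobi_step J (A_ k) (I k).1 (I k).2 (F_ k) /\
    A_ k.+1 = (F_ k)^T *m A_ k *m F_ k.

End JJacobi.

(* Main.v *)
Require Import Defs.
From mathcomp Require Import all_boot all_order all_algebra.
From mathcomp Require Import all_classical all_reals all_analysis.
From mathcomp Require Import ring lra zify.
Import Order.TTheory GRing.Theory Num.Theory.
Import numFieldNormedType.Exports.
Local Open Scope ring_scope.
Local Open Scope classical_set_scope.
Set Implicit Arguments.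
Unset Strict Implicit.

(** Following the signature of J, write A = [[A1, B], [B^T, A2]] in 2x2 blocks.
    A trigonometric step rotates rows and columns inside A1 or inside A2; a
    hyperbolic step pivots on an entry of the coupling block B, and it never
    increases the trace.  The trace is positive, so it converges, and the
    Cauchy-Schwarz inequality for A bounds the displacement of every entry in a
    hyperbolic step by the decrease of the trace ([hyp_step_drift]).  Hyperbolic
    steps are therefore asymptotically trivial, and entries of B get pivoted
    only when they are almost zero already.

    The off-diagonal entries tend to zero.  For those of A1 and A2 this is
    immediate: each is annihilated once per sweep and moved only by hyperbolic
    steps in between.  For B, look at a rotation of its two columns.  Every
    entry of B is annihilated either between the last rotation of the rows and
    this rotation of the columns, or between the latter and the next rotation of the
    rows; as only hyperbolic steps intervene, the entry is almost zero just
    before or just after the rotation ([coupling_entry_small]).  Since the angle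
    is at most pi/4, the cosine does not degenerate, and then both entries of
    each row are almost zero ([rotation_small]).  This argument does not depend
    on the order in which the six pairs are visited.

    The diagonal converges.  A step turns J A into a similar matrix, so the
    traces of the powers of J A are invariant.  Once the off-diagonal part
    vanishes, these invariants together with the limit of the trace determine
    the limits of a11 + a22, a33 + a44, (a11 - a22)^2 and (a33 - a44)^2
    ([cvg_gaps_of_power_sums]).  Angles of at most pi/4 cannot exchange the two
    diagonal entries of a block ([gap_sign_persists]), so the gaps converge
    themselves and not only their squares. *)

(** * Congruence by a transformation of a coordinate plane *)

Section PlaneCongruence.
Context {R : realType}.
Implicit Types (A F : 'M[R]_4) (i j r s : 'I_4).

Lemma mulmx_planeE A i j (a b c d : R) r s : i != j ->
  (A *m plane_mx i j a b c d) r s =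
    if s == i then A r i * a + A r j * c
    else if s == j then A r i * b + A r j * d else A r s.
Proof.
move=> ij; have ji : (j == i) = false by rewrite eq_sym (negbTE ij).
rewrite mxE; have [->|si] := eqVneq s i.
  rewrite (bigD1 i) //= (bigD1 j) ?ji //= big1 ?addr0 => [|k /andP[ki kj]].
    by rewrite !mxE !eqxx ji /=.
  by rewrite !mxE (negbTE ki) (negbTE kj) mulr0.
have [->|sj] := eqVneq s j.
  rewrite (bigD1 i) //= (bigD1 j) ?ji //= big1 ?addr0 => [|k /andP[ki kj]].
    by rewrite !mxE !eqxx ji /=.
  by rewrite !mxE (negbTE ki) (negbTE kj) mulr0.
rewrite (bigD1 s) //= big1 ?addr0 => [|k ks].
  by rewrite !mxE (negbTE si) (negbTE sj) !andbF eqxx mulr1.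
by rewrite !mxE (negbTE si) (negbTE sj) !andbF (negbTE ks) mulr0.
Qed.

Lemma congr_planeE A i j (a b c d : R) r s : i != j ->
  let F := plane_mx i j a b c d in
  (F^T *m A *m F) r s =
    if r == i then (A *m F) i s * a + (A *m F) j s * c
    else if r == j then (A *m F) i s * b + (A *m F) j s * d else (A *m F) r s.
Proof.
move=> ij F; rewrite -mulmxA -[_ *m _]trmxK trmx_mul trmxK mxE mulmx_planeE //.
by rewrite ![(A *m F)^T _ _]mxE.
Qed.

Lemma mxtraceD2 n (A : 'M[R]_n) (i j : 'I_n) : i != j ->
  \tr A = A i i + A j j + \sum_(k < n | (k != i) && (k != j)) A k k.
Proof.
by move=> ij; rewrite /mxtrace (bigD1 i) //= (bigD1 j) 1?eq_sym //= addrA.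
Qed.

Lemma mxtrace_congr_plane A i j (a b c d : R) : i != j ->
  let A' := (plane_mx i j a b c d)^T *m A *m plane_mx i j a b c d in
  \tr A - \tr A' = (A i i + A j j) - (A' i i + A' j j).
Proof.
move=> ij A'; rewrite !(mxtraceD2 _ ij).
have -> : \sum_(k < 4 | (k != i) && (k != j)) A' k k
  = \sum_(k < 4 | (k != i) && (k != j)) A k k.
  apply: eq_bigr => k /andP[ki kj].
  by rewrite /A' congr_planeE // !mulmx_planeE // (negbTE ki) (negbTE kj).
by rewrite opprD addrACA subrr addr0.
Qed.

(** With [e] the diagonal of J this is J-orthogonality; it covers circular and
    hyperbolic rotations at once. *)
Lemma plane_preserves_diag (e : 'rV[R]_4) i j (a b c d : R) : i != j ->
  a ^+ 2 * e 0 i + c ^+ 2 * e 0 j = e 0 i ->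
  a * b * e 0 i + c * d * e 0 j = 0 ->
  b ^+ 2 * e 0 i + d ^+ 2 * e 0 j = e 0 j ->
  let F := plane_mx i j a b c d in F^T *m diag_mx e *m F = diag_mx e.
Proof.
move=> ij Hii Hij Hjj F.
have ji : (j == i) = false by rewrite eq_sym (negbTE ij).
apply/matrixP=> r s; rewrite congr_planeE // !mulmx_planeE // !mxE.
rewrite ?eqxx ?ji ?(negbTE ij) /= ?mulr0n ?mulr1n ?mul0r ?addr0 ?add0r.
have [->|ri] := eqVneq r i.
  have [_|si] := eqVneq s i; first by rewrite mulr1n -[RHS]Hii; ring.
  have [_|sj] := eqVneq s j; last by rewrite !mulr0n !mul0r addr0.
  by rewrite mulr0n -[RHS]Hij; ring.
have [->|rj] := eqVneq r j; last first.
  by case: ifP => [/eqP->|_]; [|case: ifP => [/eqP->|_ //]];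
     rewrite ?(negbTE ri) ?(negbTE rj) !mulr0n !mul0r addr0.
have [->|si] := eqVneq s i; first by rewrite ji mulr0n -[RHS]Hij; ring.
have [_|sj] := eqVneq s j; first by rewrite mulr1n -[RHS]Hjj; ring.
by rewrite !mulr0n !mul0r addr0.
Qed.

End PlaneCongruence.

(** * Positive definite matrices *)

Section PositiveDefinite.
Context {R : realType}.
Implicit Types (A F : 'M[R]_4) (i j r s : 'I_4).

Lemma sym_posdef_sym A : sym_posdef A -> A^T = A.
Proof.
move=> [/is_hermitianmxP hs _]; rewrite [RHS]hs expr0 scale1r.
by apply/matrixP=> i j; rewrite !mxE.
Qed.

Lemma sym_posdefC A i j : sym_posdef A -> A i j = A j i.
Proof. by move=> hA; rewrite -[in LHS](sym_posdef_sym hA) mxE. Qed.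

Lemma sym_posdef_congr A F : sym_posdef A -> F \in unitmx ->
  sym_posdef (F^T *m A *m F).
Proof.
move=> hA uF; have sA := sym_posdef_sym hA; split.
  apply/is_hermitianmxP; rewrite expr0 scale1r.
  have -> : map_mx idfun (F^T *m A *m F)^T = (F^T *m A *m F)^T.
    by apply/matrixP=> i j; rewrite !mxE.
  by rewrite !trmx_mul trmxK sA mulmxA.
move=> x x0; rewrite !mulmxA -trmx_mul -(mulmxA _ F x).
apply: hA.2; apply: contra_neq x0 => Fx0.
by rewrite -[x](mulKmx uF) Fx0 mulmx0.
Qed.


Definition form A (x y : 'cV[R]_4) : R := (x^T *m A *m y) 0 0.

Lemma formDl A x y z : form A (x + y) z = form A x z + form A y z.
Proof. by rewrite /form linearD /= !mulmxDl mxE. Qed.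

Lemma formDr A x y z : form A x (y + z) = form A x y + form A x z.
Proof. by rewrite /form mulmxDr mxE. Qed.

Lemma formZl A (c : R) x y : form A (c *: x) y = c * form A x y.
Proof. by rewrite /form linearZ /= -!scalemxAl mxE. Qed.

Lemma formZr A (c : R) x y : form A x (c *: y) = c * form A x y.
Proof. by rewrite /form -scalemxAr mxE. Qed.

Lemma form_delta A i j : form A (delta_mx i 0) (delta_mx j 0) = A i j.
Proof. by rewrite /form trmx_delta -rowE -colE !mxE. Qed.

Lemma formC A x y : sym_posdef A -> form A x y = form A y x.
Proof.
move=> /sym_posdef_sym sA; rewrite /form -[x^T *m A *m y]trmxK [LHS]mxE.
by rewrite !trmx_mul trmxK sA mulmxA.
Qed.

Lemma form_ge0 A x : sym_posdef A -> 0 <= form A x x.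
Proof.
move=> hA; have [->|x0] := eqVneq x 0; first by rewrite /form mulmx0 mxE.
exact/ltW/hA.2.
Qed.

(** The form is nonnegative at the vector [form A y y *: x - form A x y *: y],
    where its value is the product of [form A y y] and the deficit in the
    inequality. *)
Lemma form_CauchySchwarz A x y : sym_posdef A ->
  form A x y ^+ 2 <= form A x x * form A y y.
Proof.
move=> hA; have [->|y0] := eqVneq y 0.
  by rewrite /form !mulmx0 !mxE mulr0 expr0n.
have yy0 : 0 < form A y y by exact: hA.2.
have := form_ge0 (form A y y *: x + (- form A x y) *: y) hA.
rewrite !(formDl, formDr, formZl, formZr) (formC y x hA).
move=> h; rewrite -subr_ge0 -(pmulr_rge0 _ yy0); move: h.
by congr (0 <= _); ring.
Qed.

Lemma plane_vector_ge0 A i j (u v : R) : sym_posdef A ->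
  0 <= u ^+ 2 * A i i + 2 * (u * v * A i j) + v ^+ 2 * A j j.
Proof.
move=> hA; have := form_ge0 (u *: delta_mx i 0 + v *: delta_mx j 0) hA.
rewrite !(formDl, formDr, formZl, formZr, form_delta) (sym_posdefC j i hA).
by congr (0 <= _); ring.
Qed.

(** Cauchy-Schwarz for the basis vector e_r and [u e_i + v e_j].  It will be
    used with a column of F - 1 as the second vector, so that the left-hand side
    is the displacement of an entry. *)
Lemma plane_vector_CauchySchwarz A r i j (u v : R) : sym_posdef A ->
  (A r i * u + A r j * v) ^+ 2 <=
  A r r * (u ^+ 2 * A i i + 2 * (u * v * A i j) + v ^+ 2 * A j j).
Proof.
move=> hA; have := form_CauchySchwarz (delta_mx r 0)
  (u *: delta_mx i 0 + v *: delta_mx j 0) hA.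
rewrite !(formDl, formDr, formZl, formZr, form_delta) (sym_posdefC j i hA).
by congr (_ <= _); ring.
Qed.

Lemma sym_posdef_diag_gt0 A i : sym_posdef A -> 0 < A i i.
Proof.
move=> hA; rewrite -form_delta; apply: hA.2.
apply/eqP => /matrixP/(_ i 0); rewrite !mxE !eqxx => /eqP.
by rewrite oner_eq0.
Qed.

Lemma sym_posdef_diag2_le_trace A i j : sym_posdef A -> i != j ->
  A i i + A j j <= \tr A.
Proof.
move=> hA ij; rewrite (mxtraceD2 _ ij).
by rewrite lerDl sumr_ge0 // => k _; exact/ltW/sym_posdef_diag_gt0.
Qed.

Lemma sym_posdef_diag_le_trace A i : sym_posdef A -> A i i <= \tr A.
Proof.
move=> hA; rewrite /mxtrace (bigD1 i) //= lerDl sumr_ge0 // => k _.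
exact/ltW/sym_posdef_diag_gt0.
Qed.

Lemma sym_posdef_entry_le_trace A i j : sym_posdef A -> `|A i j| <= \tr A.
Proof.
move=> hA; have T0 : 0 <= \tr A.
  exact: le_trans (ltW (sym_posdef_diag_gt0 i hA)) (sym_posdef_diag_le_trace i
    hA).
rewrite -(@ler_pXn2r _ 2) ?nnegrE // real_normK ?num_real //.
have := plane_vector_CauchySchwarz i j j 1 0 hA.
rewrite !(mulr1, mulr0, mul0r, expr0n, expr1n, addr0, mul1r) /=.
move=> /le_trans -> //; rewrite expr2; apply: ler_pM.
- exact/ltW/sym_posdef_diag_gt0.
- exact/ltW/sym_posdef_diag_gt0.
- exact: sym_posdef_diag_le_trace.
- exact: sym_posdef_diag_le_trace.
Qed.

End PositiveDefinite.

(** * Hyperbolic and trigonometric parameters *)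

Section HyperbolicScalars.
Context {R : realType}.
Implicit Types (x c s a b t : R).

Lemma cosh2_sinh2 x : cosh x ^+ 2 - sinh x ^+ 2 = 1.
Proof.
have e0 : expR x != 0 by rewrite gt_eqF ?expR_gt0.
by rewrite /cosh /sinh expRN; field.
Qed.

Lemma cosh_ge1 x : 1 <= cosh x.
Proof.
have e0 := expR_gt0 x.
have h0 : 0 < cosh x by rewrite divr_gt0 // addr_gt0 ?expR_gt0.
have := cosh2_sinh2 x; have := sqr_ge0 (sinh x); nra.
Qed.

Lemma cosh_double x : cosh (2 * x) = cosh x ^+ 2 + sinh x ^+ 2.
Proof.
have e0 : expR x != 0 by rewrite gt_eqF ?expR_gt0.
by rewrite /cosh /sinh !mulr_natl mulr2n opprD !expRD !expRN; field.
Qed.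

Lemma sinh_double x : sinh (2 * x) = 2 * cosh x * sinh x.
Proof.
have e0 : expR x != 0 by rewrite gt_eqF ?expR_gt0.
by rewrite /cosh /sinh !mulr_natl mulr2n opprD !expRD !expRN; field.
Qed.

Section PlaneQuadraticForm.
Variables (c s a b t : R).
Hypotheses (c1 : 1 <= c) (cs1 : c ^+ 2 - s ^+ 2 = 1) (S0 : 0 < a + b).
Hypothesis annihilates : c * s * (a + b) = - t * (c ^+ 2 + s ^+ 2).

(* The restriction of A to the pivot plane is [[a, t], [t, b]]; then [D] is the
   decrease of the trace caused by the hyperbolic step. *)
Let S := a + b.
Let C2 := c ^+ 2 + s ^+ 2.
Let D := S - (C2 * S + 4 * (c * s * t)).

Let C2_gt0 : 0 < C2.
Proof. by rewrite ltr_wpDr ?sqr_ge0 ?exprn_gt0 ?(lt_le_trans ltr01). Qed.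

Let tC2 : t * C2 = - (c * s * S).
Proof. by rewrite /S annihilates /C2; ring. Qed.

(* [C2] and [2 * c * s] are the hyperbolic cosine and sine of the double angle;
   the new trace of the plane block is [S / C2]. *)
Let C2D : C2 * D = 2 * s ^+ 2 * S.
Proof.
have -> : C2 * D = C2 * S - C2 ^+ 2 * S - 4 * (c * s) * (t * C2).
  by rewrite /D; ring.
rewrite tC2.
have -> : C2 * S - C2 ^+ 2 * S - 4 * (c * s) * - (c * s * S)
  = S * (C2 - (c ^+ 2 - s ^+ 2) ^+ 2) by rewrite /C2; ring.
by rewrite cs1 expr1n -[X in _ - X]cs1 /C2; ring.
Qed.

Lemma hyp_decrease_ge0 : 0 <= D.
Proof.
rewrite -(pmulr_rge0 _ C2_gt0) C2D.
by rewrite mulr_ge0 ?(ltW S0) // mulr_ge0 // sqr_ge0.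
Qed.

Lemma hyp_decrease_le : D <= S.
Proof.
rewrite -(ler_pM2l C2_gt0) C2D; apply: ler_wpM2r; first exact: ltW.
by rewrite /C2; have := cs1; lra.
Qed.

Lemma hyp_pivot_sqr_le : t ^+ 2 <= S * D.
Proof.
have C22 : 0 < C2 ^+ 2 by rewrite exprn_gt0.
rewrite -(ler_pM2l C22) -exprMn (mulrC C2) tC2.
have -> : C2 ^+ 2 * (S * D) = C2 * S * (C2 * D) by ring.
rewrite C2D -subr_ge0.
have -> : C2 * S * (2 * s ^+ 2 * S) - (- (c * s * S)) ^+ 2
   = (s * S) ^+ 2 * (c ^+ 2 + 2 * s ^+ 2) by rewrite /C2; ring.
by rewrite mulr_ge0 ?sqr_ge0 // addr_ge0 ?sqr_ge0 // mulr_ge0 ?sqr_ge0.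
Qed.

(** The left-hand side is the trace of (F - 1)^T A (F - 1), the total squared
    A-length of the displacement of the two basis vectors.  No lower bound for
    [S] enters, so a large hyperbolic angle in a small block does no harm. *)
Lemma hyp_displacement_le :
  ((c - 1) ^+ 2 * a + 2 * ((c - 1) * s * t) + s ^+ 2 * b) +
  (s ^+ 2 * a + 2 * (s * (c - 1) * t) + (c - 1) ^+ 2 * b) <= D.
Proof.
rewrite -subr_ge0 -(pmulr_rge0 _ C2_gt0).
set X := C2 * _.
(* The last two summands are multiples of the two constraints, hence zero. *)
have -> : X = 2 * S * (c - 1)
   + (t * C2 + c * s * S) * (4 * s - 8 * (c * s))
   + (c ^+ 2 - s ^+ 2 - 1) * (2 * S * (c - (c ^+ 2 - s ^+ 2 - 1) - 2)).
  by rewrite /X /D /C2 /S; ring.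
rewrite tC2 cs1 addNr subrr !mul0r !addr0.
by rewrite !mulr_ge0 ?subr_ge0 ?(ltW S0).
Qed.

End PlaneQuadraticForm.
End HyperbolicScalars.

Section Steps.
Context {R : realType}.
Implicit Types (A F : 'M[R]_4) (i j r q : 'I_4).

(** The exponentials are only needed to know that the parameters lie on the
    right branch of the hyperbola; the tangent equation becomes the polynomial
    condition that annihilates the pivot. *)
Lemma hyp_stepP A i j F : sym_posdef A -> hyp_step A i j F ->
  exists c s : R, [/\ F = plane_mx i j c s s c, 1 <= c, c ^+ 2 - s ^+ 2 = 1
    & c * s * (A i i + A j j) = - A i j * (c ^+ 2 + s ^+ 2)].
Proof.
move=> hA [x tx ->]; exists (cosh x), (sinh x).
split; rewrite ?cosh_ge1 ?cosh2_sinh2 //.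
have S0 : A i i + A j j != 0.
  by rewrite gt_eqF // addr_gt0 ?sym_posdef_diag_gt0.
have C0 : cosh x ^+ 2 + sinh x ^+ 2 != 0.
  by rewrite -cosh_double gt_eqF // (lt_le_trans ltr01) ?cosh_ge1.
move: tx; rewrite /tanh cosh_double sinh_double => /eqP.
rewrite eqr_div // => /eqP E.
apply: (@mulfI _ 2); first by rewrite pnatr_eq0.
transitivity (2 * cosh x * sinh x * (A i i + A j j)); first by ring.
by rewrite E; ring.
Qed.

(** The three cases in the choice of the angle amount to one polynomial
    condition, and [s ^+ 2 <= c ^+ 2] is what remains of the bound pi/4. *)
Lemma trig_stepP A i j F : trig_step A i j F ->
  exists c s : R, [/\ F = plane_mx i j c (- s) s c, c ^+ 2 + s ^+ 2 = 1,
    0 <= c, s ^+ 2 <= c ^+ 2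
    & c * s * (A i i - A j j) = A i j * (c ^+ 2 - s ^+ 2)].
Proof.
move=> [x [/andP[lx ux] hx] ->]; exists (cos x), (sin x).
have pi0 : 0 < pi :> R := pi_gt0 R.
have c2 : cos (2 * x) = cos x ^+ 2 - sin x ^+ 2.
  by rewrite mulr_natl mulr2n cosD -!expr2.
have s2 : sin (2 * x) = 2 * (cos x * sin x).
  by rewrite mulr_natl mulr2n sinD; ring.
have c2_ge0 : 0 <= cos (2 * x) by apply: cos_ge0_pihalf; lra.
split; rewrite ?cos2Dsin2 //.
- by apply: cos_ge0_pihalf; lra.
- by rewrite -subr_ge0 -c2.
rewrite -c2; case: ifP hx => [/eqP -> ->|t0].
  by rewrite sin0 mulr0 !mul0r.
case: ifP => [/eqP -> hx|u0 tx].
  have -> : cos (2 * x) = 0.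
    case: hx => ->.
      by rewrite (_ : 2 * (pi / 4) = pi / 2) ?cos_pihalf //; field.
    by rewrite (_ : 2 * - (pi / 4) = - (pi / 2)) ?cosN ?cos_pihalf //; field.
  by rewrite subrr !mulr0.
have u0' : A i i - A j j != 0 by rewrite subr_eq0 u0.
(* Division by zero yields zero, so a vanishing cosine would make [tan] zero,
   which differs from the prescribed nonzero quotient. *)
have [c20|c20] := eqVneq (cos (2 * x)) 0.
  move: tx; rewrite /tan c20 invr0 mulr0 => /esym/eqP.
  rewrite mulf_eq0 invr_eq0 (negbTE u0') orbF mulf_eq0 t0 orbF pnatr_eq0.
  by [].
move: tx; rewrite /tan => /eqP; rewrite eqr_div // s2 => /eqP E.
apply: (@mulfI _ 2); first by rewrite pnatr_eq0.
by rewrite !mulrA in E *.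
Qed.

End Steps.

(** * Effect of a single step *)

Section StepEffects.
Context {R : realType}.
Implicit Types (A F : 'M[R]_4) (i j r q : 'I_4).

Section TrigStep.
Variables (A : 'M[R]_4) (i j : 'I_4) (F : 'M[R]_4).
Hypotheses (ij : i != j) (hA : sym_posdef A) (hF : trig_step A i j F).
Let A' := F^T *m A *m F.

Let ji : (j == i) = false. Proof. by rewrite eq_sym (negbTE ij). Qed.

Lemma trig_step_fixed r q : r != i -> r != j -> q != i -> q != j ->
  A' r q = A r q.
Proof.
move=> ri rj qi qj; have [c [s [FE _ _ _ _]]] := trig_stepP hF.
by rewrite /A' FE congr_planeE // !mulmx_planeE // (negbTE ri) (negbTE rj)
  (negbTE qi) (negbTE qj).
Qed.

Lemma trig_step_annihilates : A' i j = 0.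
Proof.
have [c [s [FE _ _ _ E]]] := trig_stepP hF.
rewrite /A' FE congr_planeE // !mulmx_planeE // !eqxx ji (sym_posdefC j i hA).
transitivity (A i j * (c ^+ 2 - s ^+ 2) - c * s * (A i i - A j j)).
  by ring.
by rewrite E subrr.
Qed.

Lemma trig_step_trace : \tr A' = \tr A.
Proof.
have [c [s [FE cs1 _ _ _]]] := trig_stepP hF.
apply/esym/eqP; rewrite -subr_eq0 /A' FE mxtrace_congr_plane //.
rewrite !congr_planeE // !mulmx_planeE // !eqxx ji (sym_posdefC j i hA).
apply/eqP; transitivity ((A i i + A j j) * (1 - (c ^+ 2 + s ^+ 2))).
  by ring.
by rewrite cs1 subrr mulr0.
Qed.

Lemma trig_step_rotates : exists c s : R,
  [/\ c ^+ 2 + s ^+ 2 = 1, 0 <= c, s ^+ 2 <= c ^+ 2 &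
   forall r, r != i -> r != j ->
     A' r i = A r i * c + A r j * s /\ A' r j = A r j * c - A r i * s].
Proof.
have [c [s [FE cs1 c0 sc _]]] := trig_stepP hF; exists c, s.
split=> // r ri rj; rewrite /A' FE !congr_planeE // !mulmx_planeE //.
by rewrite (negbTE ri) (negbTE rj) !eqxx ji; split=> //; ring.
Qed.

(** The new gap is [(c^2 - s^2) u + 4 c s a_ij] for the old gap [u], and the
    first coefficient is nonnegative: up to the size of the pivot, a rotation by
    at most pi/4 keeps the order of the two diagonal entries. *)
Lemma trig_step_gap :
  - (2 * `|A i j| * `|A i i - A j j|) <= (A i i - A j j) * (A' i i - A' j j).
Proof.
have [c [s [FE cs1 c0 sc _]]] := trig_stepP hF.
set u := A i i - A j j.
have -> : u * (A' i i - A' j j) =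
    (c ^+ 2 - s ^+ 2) * u ^+ 2 + 2 * (c * s) * (2 * (A i j * u)).
  rewrite /A' FE !congr_planeE // !mulmx_planeE // !eqxx ji.
  by rewrite (sym_posdefC j i hA) /u; ring.
rewrite -mulrA -normrM; set v := A i j * u.
have h1 : 0 <= (c ^+ 2 - s ^+ 2) * u ^+ 2.
  by rewrite mulr_ge0 ?sqr_ge0 // subr_ge0.
have h2 : `|2 * (c * s) * (2 * v)| <= 2 * `|v|.
  rewrite !normrM !(ger0_norm (ler0n _ 2)) mulrA ler_wpM2r // mulrC ler_piMr //.
  rewrite -normrM.
  suff : 2 * `|c * s| <= 1 by [].
  case: (ger0P (c * s)) => _.
    have := sqr_ge0 (c - s).
    have -> : (c - s) ^+ 2 = c ^+ 2 + s ^+ 2 - 2 * (c * s) by ring.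
    by rewrite cs1; lra.
  have := sqr_ge0 (c + s).
  have -> : (c + s) ^+ 2 = c ^+ 2 + s ^+ 2 + 2 * (c * s) by ring.
  by rewrite cs1; lra.
by have := ler_norm (- (2 * (c * s) * (2 * v))); rewrite normrN; lra.
Qed.

End TrigStep.

Section HypStep.
Variables (A : 'M[R]_4) (i j : 'I_4) (F : 'M[R]_4).
Hypotheses (ij : i != j) (hA : sym_posdef A) (hF : hyp_step A i j F).
Let A' := F^T *m A *m F.

Let ji : (j == i) = false. Proof. by rewrite eq_sym (negbTE ij). Qed.

Let S0 : 0 < A i i + A j j.
Proof. by rewrite addr_gt0 ?sym_posdef_diag_gt0. Qed.

Lemma hyp_step_annihilates : A' i j = 0.
Proof.
have [c [s [FE _ _ E]]] := hyp_stepP hA hF.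
rewrite /A' FE congr_planeE // !mulmx_planeE // !eqxx ji (sym_posdefC j i hA).
transitivity (A i j * (c ^+ 2 + s ^+ 2) + c * s * (A i i + A j j)).
  by ring.
by rewrite E mulNr subrr.
Qed.

Let trace_decrease c s : F = plane_mx i j c s s c ->
  \tr A - \tr A' = A i i + A j j -
    ((c ^+ 2 + s ^+ 2) * (A i i + A j j) + 4 * (c * s * A i j)).
Proof.
move=> FE; rewrite /A' FE mxtrace_congr_plane // !congr_planeE //.
by rewrite !mulmx_planeE // !eqxx ji (sym_posdefC j i hA); ring.
Qed.

Lemma hyp_step_trace : \tr A' <= \tr A.
Proof.
have [c [s [FE c1 cs1 E]]] := hyp_stepP hA hF.
by rewrite -subr_ge0 (trace_decrease FE) hyp_decrease_ge0.
Qed.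

(** An entry with one index outside the pivot plane moves by an inner product of
    a basis vector with a displacement vector; both diagonal entries of the
    plane drop by half the trace decrease; the pivot itself becomes zero, and it
    was small already.  Each of these squares is at most the trace times its
    decrease. *)
Lemma hyp_step_drift r q : (A' r q - A r q) ^+ 2 <= \tr A * (\tr A - \tr A').
Proof.
have [c [s [FE c1 cs1 E]]] := hyp_stepP hA hF.
set D := \tr A - \tr A'.
have D0 : 0 <= D by rewrite subr_ge0 hyp_step_trace.
have T0 : 0 <= \tr A.
  exact: le_trans (ltW (sym_posdef_diag_gt0 i hA)) (sym_posdef_diag_le_trace i
    hA).
have ST : A i i + A j j <= \tr A by exact: sym_posdef_diag2_le_trace.
have DE : D = _ := trace_decrease FE.
have DS : D <= A i i + A j j by rewrite DE; apply: hyp_decrease_le.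
have tD : A i j ^+ 2 <= \tr A * D.
  apply: le_trans (ler_wpM2r D0 ST).
  by rewrite [in leRHS]DE; apply: hyp_pivot_sqr_le.
have hD : (- (D / 2)) ^+ 2 <= \tr A * D.
  have : D * D <= \tr A * D by rewrite ler_wpM2r // (le_trans DS).
  by have := mulr_ge0 D0 D0; nra.
set qi := (c - 1) ^+ 2 * A i i + 2 * ((c - 1) * s * A i j) + s ^+ 2 * A j j.
set qj := s ^+ 2 * A i i + 2 * (s * (c - 1) * A i j) + (c - 1) ^+ 2 * A j j.
have qi0 : 0 <= qi by exact: plane_vector_ge0.
have qj0 : 0 <= qj by exact: plane_vector_ge0.
have qD : qi + qj <= D by rewrite DE; apply: hyp_displacement_le.
have col r' q' : r' != i -> r' != j -> (A' r' q' - A r' q') ^+ 2 <= \tr A * D.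
  move=> ri rj.
  have rT : A r' r' <= \tr A by exact: sym_posdef_diag_le_trace.
  have r0 : 0 <= A r' r' by exact/ltW/sym_posdef_diag_gt0.
  rewrite /A' FE congr_planeE // !mulmx_planeE // (negbTE ri) (negbTE rj).
  case: eqP => [->|_]; last case: eqP => [->|_].
  - have -> : A r' i * c + A r' j * s - A r' i = A r' i * (c - 1) + A r' j * s.
      by ring.
    apply: le_trans (plane_vector_CauchySchwarz _ _ _ _ _ hA) _.
    by apply: ler_pM => //; rewrite -/qi; lra.
  - have -> : A r' i * s + A r' j * c - A r' j = A r' i * s + A r' j * (c - 1).
      by ring.
    apply: le_trans (plane_vector_CauchySchwarz _ _ _ _ _ hA) _.
    by apply: ler_pM => //; rewrite -/qj; lra.
  - by rewrite subrr expr0n mulr_ge0.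
have A'C : A' q r = A' r q.
  suff A'T : A'^T = A' by rewrite -[in LHS]A'T mxE.
  by rewrite /A' !trmx_mul trmxK (sym_posdef_sym hA) mulmxA.
have diag_change x y z : z = - (D / 2) + (c ^+ 2 - s ^+ 2 - 1) * (x - y) / 2 ->
    z ^+ 2 <= \tr A * D.
  by rewrite cs1 subrr !mul0r addr0 => ->.
have [ri|ri] := eqVneq r i; last have [rj|rj] := eqVneq r j; last exact: col.
- subst r; have [qi'|qi'] := eqVneq q i; last have [qj'|qj'] := eqVneq q j.
  + subst q; apply: (diag_change (A i i) (A j j)).
    rewrite DE /A' FE congr_planeE // !mulmx_planeE // !eqxx.
    by rewrite (sym_posdefC j i hA); field.
  + by subst q; rewrite hyp_step_annihilates sub0r sqrrN.
  + by rewrite -A'C (sym_posdefC _ _ hA); exact: col.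
- subst r; have [qi'|qi'] := eqVneq q i; last have [qj'|qj'] := eqVneq q j.
  + by subst q; rewrite -A'C hyp_step_annihilates (sym_posdefC _ _ hA) sub0r
    sqrrN.
  + subst q; apply: (diag_change (A j j) (A i i)).
    rewrite DE /A' FE congr_planeE // !mulmx_planeE // !eqxx ji.
    by rewrite (sym_posdefC j i hA); field.
  + by rewrite -A'C (sym_posdefC _ _ hA); exact: col.
Qed.

End HypStep.
End StepEffects.

(** * Cyclic orderings and the signature of J *)

Section CyclicStrategy.
Variable O : 6.-tuple ('I_4 * 'I_4).
Hypothesis hO : is_ordering O.

Lemma strategy_lt k : ((cyclic_strategy O k).1 < (cyclic_strategy O k).2)%N.
Proof.
have := mem_tnth (Ordinal (ltn_pmod k (isT : (0 < 6)%N))) O.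
by rewrite (perm_mem hO) mem_enum inE.
Qed.

Lemma strategy_inj k l :
  cyclic_strategy O k = cyclic_strategy O l -> k = l %[mod 6].
Proof.
rewrite /cyclic_strategy !(tnth_nth (ord0, ord0)) /= => /eqP.
rewrite nth_uniq ?size_tuple ?ltn_pmod //; first by move/eqP.
by rewrite (perm_uniq hO) enum_uniq.
Qed.

Lemma strategy_hits k (i j : 'I_4) : (i < j)%N ->
  exists2 d, (d < 6)%N & cyclic_strategy O (k + d) = (i, j).
Proof.
move=> ij; have /tnthP[q qE] : (i, j) \in O.
  by rewrite (perm_mem hO) mem_enum inE.
exists ((q + (6 - k %% 6)) %% 6)%N; first by rewrite ltn_pmod.
rewrite qE /cyclic_strategy; congr tnth; apply/val_inj => /=.
by have := ltn_ord q; lia.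
Qed.

End CyclicStrategy.

Notation o0 := (@Ordinal 4 0 isT).
Notation o1 := (@Ordinal 4 1 isT).
Notation o2 := (@Ordinal 4 2 isT).
Notation o3 := (@Ordinal 4 3 isT).

Section Signature.
Context {R : realType}.

Lemma J4E (i : 'I_4) : J4 i i = (if (i < 2)%N then 1 else -1) :> R.
Proof. by rewrite !mxE eqxx mulr1n. Qed.

Lemma J4_sqr : J4 *m J4 = 1%:M :> 'M[R]_4.
Proof.
rewrite mulmx_diag; apply/matrixP=> i j; rewrite !mxE.
by case: ifP => _; rewrite ?mulrNN mulr1.
Qed.

Lemma J4_diag_eq (i j : 'I_4) :
  (J4 i i == J4 j j :> R) = ((i < 2)%N == (j < 2)%N).
Proof.
have n1 : (1 == -1 :> R) = false.
  by apply/negbTE; rewrite -subr_eq0 opprK (_ : 1 + 1 = 2%:R) ?pnatr_eq0.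
by rewrite !J4E; do 2 case: ifP; rewrite ?eqxx ?n1 // eq_sym n1.
Qed.

Lemma same_sign_pair (i j : 'I_4) : (i < j)%N ->
  J4 i i == J4 j j :> R -> (i, j) = (o0, o1) \/ (i, j) = (o2, o3).
Proof.
rewrite J4_diag_eq.
by case: i => [[|[|[|[|]]]] //= hi]; case: j => [[|[|[|[|]]]] //= hj] // _ _;
  [left|right]; congr (_, _); apply: val_inj.
Qed.

End Signature.

(** * Invariants of a J-Jacobi step *)

Section JJacobiStep.
Context {R : realType}.
Variables (A : 'M[R]_4) (i j : 'I_4) (F : 'M[R]_4).
Hypotheses (ij : i != j) (hA : sym_posdef A).
Hypothesis step : J_jacobi_step J4 A i j F.
Let A' := F^T *m A *m F.

Lemma J_jacobi_step_orthogonal : F^T *m J4 *m F = J4.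
Proof.
move: step; rewrite /J_jacobi_step /J4.
set e := \row_k _; have eE k : diag_mx e k k = e 0 k.
  by rewrite mxE eqxx mulr1n.
rewrite !eE; case: ifP => [/eqP eij hF|nij hF].
  have [c [s [-> cs1 _ _ _]]] := trig_stepP hF.
  apply: plane_preserves_diag => //; rewrite ?eij.
  - by rewrite -mulrDl cs1 mul1r.
  - by ring.
  - by rewrite sqrrN -mulrDl addrC cs1 mul1r.
have [c [s [-> _ cs1 _]]] := hyp_stepP hA hF.
have {}nij : e 0 j = - e 0 i.
  move: nij; rewrite !mxE; do 2 case: ifP => _; rewrite ?eqxx ?opprK //.
apply: plane_preserves_diag => //; rewrite nij.
- by rewrite mulrN -mulrBl cs1 mul1r.
- by ring.
- by rewrite mulrN addrC addrC -mulrBl -opprB cs1 mulN1r.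
Qed.

Lemma J_jacobi_step_left_inverse : J4 *m F^T *m J4 *m F = 1%:M.
Proof.
by rewrite -!mulmxA (mulmxA F^T) J_jacobi_step_orthogonal J4_sqr.
Qed.

Lemma J_jacobi_step_unit : F \in unitmx.
Proof. by have [_] := mulmx1_unit J_jacobi_step_left_inverse. Qed.

Lemma J_jacobi_step_posdef : sym_posdef A'.
Proof. exact: sym_posdef_congr J_jacobi_step_unit. Qed.

(** J-orthogonality says that J F^T J is the inverse of F, so J A is replaced by
    the similar matrix F^-1 (J A) F. *)
Lemma J_jacobi_step_spectrum n :
  \tr ((J4 *m A') ^+ n) = \tr ((J4 *m A) ^+ n).
Proof.
set G := J4 *m F^T *m J4.
have GF : G *m F = 1%:M := J_jacobi_step_left_inverse.
have FG : F *m G = 1%:M by exact: mulmx1C.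
have -> : J4 *m A' = G *m (J4 *m A) *m F.
  by rewrite /A' /G !mulmxA -(mulmxA _ J4 J4) J4_sqr mulmx1.
move: (J4 *m A) => M; clearbody G.
have -> : (G *m M *m F) ^+ n = G *m M ^+ n *m F.
  elim: n => [|n IH]; first by rewrite !expr0 mulmx1 GF.
  rewrite !exprS IH -!mulmxE !mulmxA.
  by rewrite -(mulmxA _ F G) FG mulmx1.
by rewrite mxtrace_mulC mulmxA FG mul1mx.
Qed.

Lemma J_jacobi_step_annihilates : A' i j = 0.
Proof.
move: step; rewrite /J_jacobi_step; case: ifP => _ hF.
  exact: (trig_step_annihilates ij hA hF).
exact: (hyp_step_annihilates ij hA hF).
Qed.

Lemma J_jacobi_step_trace : \tr A' <= \tr A.
Proof.
move: step; rewrite /J_jacobi_step; case: ifP => _ hF.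
  by rewrite (trig_step_trace ij hA hF).
exact: (hyp_step_trace ij hA hF).
Qed.

End JJacobiStep.

(** * Limits of sequences of numbers and matrices *)

Section RealSequences.
Context {R : realType}.
Implicit Types (f g u : nat -> R).

Lemma cvg0_bounded_mul f g (B : R) :
  (forall k, `|f k| <= B) -> g @ \oo --> 0 -> (fun k => f k * g k) @ \oo --> 0.
Proof.
move=> fB g0; apply: norm_cvg0.
have Bg : (fun k => B * `|g k|) @ \oo --> 0.
  by rewrite -[X in _ --> X](mulr0 B); apply: cvgMl_tmp; rewrite -(normr0 R);
    exact: cvg_norm.
apply: squeeze_cvgr (cvg_cst 0) Bg; near=> k.
by rewrite normr_ge0 normrM ler_wpM2r.
Unshelve. all: by end_near. Qed.

Lemma cvg_sum0 (I : finType) (f : I -> nat -> R) :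
  (forall l, f l @ \oo --> 0) -> (fun k => \sum_l f l k) @ \oo --> 0.
Proof.
move=> f0.
have : (fun k => \sum_l f l k) @ \oo --> \sum_(l : I) (0 : R).
  by apply: cvg_big => [|l _]; [exact: add_continuous|exact: f0].
by rewrite big1.
Qed.

(** If the limit of the squares is positive, the sign of [u] is eventually
    constant, because a change of sign would make some product [u k * u k.+1]
    bounded away from zero and negative. *)
Lemma cvgn_of_sqr u (L : R) : (fun k => u k ^+ 2) @ \oo --> L ->
  (forall e, 0 < e -> \forall k \near \oo, - e <= u k * u k.+1) -> cvgn u.
Proof.
move=> uL hu.
have uL' : (fun k => `|u k|) @ \oo --> Num.sqrt L.
  under eq_fun do rewrite -sqrtr_sqr.
  exact: (continuous_cvg _ (@sqrt_continuous R L) uL).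
have [L0|L0] := lerP L 0.
  apply: (cvgP 0); apply: norm_cvg0; move: uL'.
  by rewrite ler0_sqrtr.
have s0 : 0 < Num.sqrt L by rewrite sqrtr_gt0.
set l := Num.sqrt L in uL' s0.
have l2 : l / 2 < l by lra.
have e0 : 0 < (l / 2) ^+ 2 by rewrite exprn_gt0 // divr_gt0.
have [N1 _ big] := cvgr_gt _ uL' _ l2.
have [N2 _ sign] := hu _ e0.
have pos k : (N1 <= k)%N -> (N2 <= k)%N -> 0 < u k * u k.+1.
  move=> k1 k2; have /= a := big k k1; have /= b := big k.+1 (leqW k1).
  have /= := sign k k2; rewrite ltNge => c; apply/negP => d.
  have := ler0_norm d; rewrite normrM; nra.
pose N := maxn N1 N2.
have same d : 0 < u N * u (N + d)%N.
  elim: d => [|d IH].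
    rewrite addn0 -expr2 -real_normK ?num_real // exprn_gt0 //.
    by have /= := big N (leq_maxl _ _); lra.
  have := pos (N + d)%N; rewrite -addnS => /(_ _ _)h.
  have {}h : 0 < u (N + d)%N * u (N + d.+1)%N.
    by apply: h; apply: leq_trans (leq_addr _ _); rewrite ?leq_maxl ?leq_maxr.
  have := mulr_gt0 IH h; rewrite mulrA -(mulrA (u N)) -expr2 mulrAC.
  by rewrite pmulr_lgt0 // exprn_even_gt0 //=; apply: contraTneq IH => ->;
    rewrite mulr0 ltxx.
have [uN|uN] := ltP 0 (u N).
  apply: (cvgP l); apply: cvg_trans uL'; apply: near_eq_cvg;
    exists N => // k /= Nk.
  have := same (k - N)%N; rewrite subnKC // pmulr_rgt0 // => uk.
  by rewrite gtr0_norm.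
apply: (cvgP (- l)).
apply: cvg_trans (cvgN uL'); apply: near_eq_cvg; exists N => // k /= Nk.
have uk : u k < 0 by have := same (k - N)%N; rewrite subnKC //; nra.
by rewrite fctE ltr0_norm // opprK.
Qed.

End RealSequences.

Section PowerSums.
Context {R : realType}.

(** Put p = x + y, q = z + w, u = (x - y)^2 and v = (z - w)^2.  The sums of
    powers give the limits of p, q, u + v and p u - q v, and
    (p + q) u = q (u + v) + (p u - q v), (p + q) v = p (u + v) - (p u - q v).
    Division by p + q is possible in the limit unless all four sequences tend to
    zero. *)
Lemma cvg_gaps_of_power_sums (x y z w : nat -> R) (t0 t1 t2 t3 : R) :
  (forall k, 0 < x k) -> (forall k, 0 < y k) ->
  (forall k, 0 < z k) -> (forall k, 0 < w k) ->
  (fun k => x k + y k + z k + w k) @ \oo --> t0 ->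
  (fun k => x k + y k - z k - w k) @ \oo --> t1 ->
  (fun k => x k ^+ 2 + y k ^+ 2 + z k ^+ 2 + w k ^+ 2) @ \oo --> t2 ->
  (fun k => x k ^+ 3 + y k ^+ 3 - z k ^+ 3 - w k ^+ 3) @ \oo --> t3 ->
  cvgn (fun k => (x k - y k) ^+ 2) /\ cvgn (fun k => (z k - w k) ^+ 2).
Proof.
move=> x0 y0 z0 w0 h0 h1 h2 h3.
pose T k := x k + y k + z k + w k.
have T_gt0 k : 0 < T k by rewrite !addr_gt0.
have [t00|t0_neq0] := eqVneq t0 0.
  have gap (f g : nat -> R) : (forall k, 0 < f k) -> (forall k, 0 < g k) ->
      (forall k, f k + g k <= T k) -> cvgn (fun k => (f k - g k) ^+ 2).
    move=> f0 g0 fgT; apply: (cvgP 0).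
    have TT : (fun k => T k * T k) @ \oo --> t0 * t0 by exact: cvgM.
    rewrite t00 mulr0 in TT.
    apply: squeeze_cvgr (cvg_cst 0) TT; near=> k.
    by rewrite sqr_ge0 /=; have := f0 k; have := g0 k; have := fgT k; nra.
  split; apply: gap => // k; rewrite /T; have := x0 k; have := y0 k;
    have := z0 k; have := w0 k; lra.
pose p k := x k + y k; pose q k := z k + w k.
have hp : p @ \oo --> (t0 + t1) / 2.
  have -> : p = (fun k => (T k + (x k + y k - z k - w k)) / 2).
    by apply/funext => k; rewrite /p /T; field.
  by apply: cvgMr_tmp; apply: cvgD.
have hq : q @ \oo --> (t0 - t1) / 2.
  have -> : q = (fun k => (T k - (x k + y k - z k - w k)) / 2).
    by apply/funext => k; rewrite /q /T; field.
  by apply: cvgMr_tmp; apply: cvgB.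
have pow (f : nat -> R) (l : R) n : f @ \oo --> l ->
  (fun k => f k ^+ n) @ \oo --> l ^+ n.
  by move=> fl; exact: (continuous_cvg _ (@exprn_continuous R n l) fl).
pose u k := (x k - y k) ^+ 2; pose v k := (z k - w k) ^+ 2.
have [s huv] : exists s : R, (fun k => u k + v k) @ \oo --> s.
  have -> : (fun k => u k + v k) = (fun k =>
      2 * (x k ^+ 2 + y k ^+ 2 + z k ^+ 2 + w k ^+ 2) - p k ^+ 2 - q k ^+ 2).
    by apply/funext => k; rewrite /u /v /p /q; ring.
  eexists; apply: cvgB; [apply: cvgB|exact: pow hq]; last exact: pow hp.
  exact: cvgMl_tmp h2.
have [r hpq] : exists r : R, (fun k => p k * u k - q k * v k) @ \oo --> r.
  have -> : (fun k => p k * u k - q k * v k) = (fun k =>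
      (4 * (x k ^+ 3 + y k ^+ 3 - z k ^+ 3 - w k ^+ 3)
       - p k ^+ 3 + q k ^+ 3) / 3).
    by apply/funext => k; rewrite /u /v /p /q; field.
  eexists; apply: cvgMr_tmp; apply: cvgD; [apply: cvgB|exact: pow hq];
    last exact: pow hp.
  exact: cvgMl_tmp h3.
have hTV : (fun k => (T k)^-1) @ \oo --> t0^-1 by exact: cvgV.
split.
- have -> : (fun k => (x k - y k) ^+ 2) = (fun k =>
      (T k)^-1 * (q k * (u k + v k) + (p k * u k - q k * v k))).
    apply/funext => k; rewrite -[LHS](mulKf (lt0r_neq0 (T_gt0 k))).
    by congr (_ * _); rewrite /u /v /p /q /T; ring.
  by apply: cvgP; apply: cvgM hTV _; apply: cvgD hpq; apply: cvgM hq huv.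
- have -> : (fun k => (z k - w k) ^+ 2) = (fun k =>
      (T k)^-1 * (p k * (u k + v k) - (p k * u k - q k * v k))).
    apply/funext => k; rewrite -[LHS](mulKf (lt0r_neq0 (T_gt0 k))).
    by congr (_ * _); rewrite /u /v /p /q /T; ring.
  by apply: cvgP; apply: cvgM hTV _; apply: cvgB hpq; apply: cvgM hp huv.
Unshelve. all: by end_near. Qed.

End PowerSums.

Section MatrixSequences.
Context {R : realType}.
Variable n : nat.
Implicit Types (X Y : nat -> 'M[R]_n.+1).

Lemma cvg_matrix_entrywise X (L : 'M[R]_n.+1) :
  (forall i j, (fun k => X k i j) @ \oo --> L i j) -> X @ \oo --> L.
Proof.
move=> XL S [P LP PS].
have : \forall k \near \oo, forall i j, P i j (X k i j).
  by apply: filter_forall => i; apply: filter_forall => j; apply: XL; exact: LP.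
by apply: filterS => k Pk; apply: PS.
Qed.

Definition bounded_entries X :=
  exists B : R, forall k i j, `|X k i j| <= B.

Definition vanishing_entries X :=
  forall i j, (fun k => X k i j) @ \oo --> 0.

Lemma bounded_entriesM X Y : bounded_entries X -> bounded_entries Y ->
  bounded_entries (fun k => X k *m Y k).
Proof.
move=> [B XB] [C YC]; exists (\sum_(l < n.+1) B * C) => k i j; rewrite mxE.
apply: le_trans (ler_norm_sum _ _ _) _; apply: ler_sum => l _.
by rewrite normrM ler_pM.
Qed.

Lemma bounded_entriesX X d : bounded_entries X ->
  bounded_entries (fun k => X k ^+ d).
Proof.
move=> Xb; elim: d => [|d IH]; last first.
  by under eq_fun do rewrite exprS; exact: bounded_entriesM.
exists 1 => k i j; rewrite expr0 mxE.
by case: eqP => _; rewrite ?normr1 ?normr0.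
Qed.

Lemma vanishing_entriesD X Y : vanishing_entries X -> vanishing_entries Y ->
  vanishing_entries (fun k => X k + Y k).
Proof.
move=> X0 Y0 i j; under eq_fun do rewrite mxE.
by have := cvgD (X0 i j) (Y0 i j); rewrite addr0; exact.
Qed.

Lemma vanishing_entriesMl X Y : bounded_entries X -> vanishing_entries Y ->
  vanishing_entries (fun k => X k *m Y k).
Proof.
move=> [B XB] Y0 i j; under eq_fun do rewrite mxE.
apply: cvg_sum0 => l.
exact: cvg0_bounded_mul (fun k => XB k i l) (Y0 l j).
Qed.

Lemma vanishing_entriesMr X Y : vanishing_entries X -> bounded_entries Y ->
  vanishing_entries (fun k => X k *m Y k).
Proof.
move=> X0 [B YB] i j; under eq_fun do rewrite mxE.
apply: cvg_sum0 => l.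
under eq_fun do rewrite mulrC.
exact: cvg0_bounded_mul (fun k => YB k l j) (X0 i l).
Qed.

(** By induction from
    X^(d+1) - Y^(d+1) = X (X^d - Y^d) + (X - Y) Y^d. *)
Lemma vanishing_entriesX X Y d : bounded_entries X -> bounded_entries Y ->
  vanishing_entries (fun k => X k - Y k) ->
  vanishing_entries (fun k => X k ^+ d - Y k ^+ d).
Proof.
move=> Xb Yb XY; elim: d => [|d IH].
  move=> i j; under eq_fun do rewrite !expr0 subrr mxE.
  exact: cvg_cst.
have -> : (fun k => X k ^+ d.+1 - Y k ^+ d.+1) = (fun k =>
    X k *m (X k ^+ d - Y k ^+ d) + (X k - Y k) *m Y k ^+ d).
  by apply/funext => k; rewrite !exprS !mulmxE mulrBr mulrBl addrA subrK.
apply: vanishing_entriesD; first exact: vanishing_entriesMl.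
by apply: vanishing_entriesMr => //; exact: bounded_entriesX.
Qed.

Lemma cvg_mxtrace0 X : vanishing_entries X -> (fun k => \tr (X k)) @ \oo --> 0.
Proof.
by move=> X0; apply: cvg_sum0 => i; exact: X0.
Qed.

Lemma mxtrace_diagX (e : 'rV[R]_n.+1) d :
  \tr (diag_mx e ^+ d) = \sum_i e 0 i ^+ d.
Proof.
have -> : diag_mx e ^+ d = diag_mx (\row_i e 0 i ^+ d).
  elim: d => [|d IH].
    by apply/matrixP => i j; rewrite !mxE expr0.
  rewrite exprS IH -mulmxE mulmx_diag; congr diag_mx.
  by apply/rowP => i; rewrite !mxE exprS.
by rewrite mxtrace_diag; apply: eq_bigr => i _; rewrite mxE.
Qed.

End MatrixSequences.

(** * The off-diagonal part vanishes *)

(** Each of the two coordinates is small before or after the rotation.  If the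
    mixed pair [x], [y'] is small then so is [y], since [y * c = y' + x * s] and
    [c] is at least 1/2; the other mixed case is symmetric, and when both new
    coordinates are small the rotation can be inverted. *)
Lemma rotation_small {R : realType} (c s x y x' y' b : R) :
  c ^+ 2 + s ^+ 2 = 1 -> 0 <= c -> s ^+ 2 <= c ^+ 2 ->
  x' = x * c + y * s -> y' = y * c - x * s ->
  `|x| <= b \/ `|x'| <= b -> `|y| <= b \/ `|y'| <= b ->
  `|x| <= 4 * b /\ `|y| <= 4 * b.
Proof.
move=> cs1 c0 sc xE yE.
have c2 : 1 / 2 <= c by nra.
have c1 : `|c| <= 1 by rewrite (ger0_norm c0); nra.
have s1 : `|s| <= 1 by rewrite ler_norml; apply/andP; split; nra.
have s1N : `|- s| <= 1 by rewrite normrN.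
have prod (u v w : R) : `|u| <= w -> `|v| <= 1 -> `|u * v| <= w.
  by move=> uw v1; rewrite normrM (le_trans _ uw) // ler_piMr.
have bound (u v g : R) : `|g| <= 1 -> `|u| <= b -> `|v| <= b ->
    `|u * c + v * g| <= 4 * b.
  move=> g1 ub vb; have := ler_normD (u * c) (v * g).
  have := prod _ _ _ ub c1; have := prod _ _ _ vb g1.
  by have := normr_ge0 u; lra.
have divide (u v g : R) : `|g| <= 1 -> `|v| <= b -> `|u * c + v * g| <= b ->
    `|u| <= 4 * b.
  move=> g1 vb uvb; have := prod _ _ _ vb g1.
  have := ler_normB (u * c + v * g) (v * g);
    rewrite addrK normrM (ger0_norm c0).
  by have := normr_ge0 u; nra.
have weaken (u : R) : `|u| <= b -> `|u| <= 4 * b by have := normr_ge0 u; lra.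
have xE' : x = x' * c + y' * (- s) by rewrite xE yE -[LHS]mulr1 -cs1; ring.
have yE' : y = y' * c + x' * s by rewrite xE yE -[LHS]mulr1 -cs1; ring.
case=> xb [] yb; split; try exact: weaken.
- by apply: (divide y x (- s)) => //; rewrite mulrN -yE.
- by apply: (divide x y s) => //; rewrite -xE.
- by rewrite xE'; apply: bound.
- by rewrite yE'; apply: bound.
Qed.

Section Process.
Context {R : realType}.
Variables (O : 6.-tuple ('I_4 * 'I_4)) (A_ F_ : nat -> 'M[R]_4).
Hypothesis hO : is_ordering O.
Hypothesis A0 : sym_posdef (A_ 0%N).
Let I := cyclic_strategy O.
Hypothesis step : forall k, J_jacobi_step J4 (A_ k) (I k).1 (I k).2 (F_ k).
Hypothesis next : forall k, A_ k.+1 = (F_ k)^T *m A_ k *m F_ k.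

Let pivot_neq k : (I k).1 != (I k).2.
Proof. by rewrite neq_ltn strategy_lt. Qed.

Lemma iterate_posdef k : sym_posdef (A_ k).
Proof.
elim: k => // k IH; rewrite next.
exact: J_jacobi_step_posdef (pivot_neq k) IH (step k).
Qed.

Lemma iterate_trace_le k : \tr (A_ k.+1) <= \tr (A_ k).
Proof.
rewrite next.
exact: J_jacobi_step_trace (pivot_neq k) (iterate_posdef k) (step k).
Qed.

Lemma iterate_trace_le0 k : \tr (A_ k) <= \tr (A_ 0%N).
Proof. by elim: k => // k; apply: le_trans (iterate_trace_le k). Qed.

Lemma iterate_entry_le k r q : `|A_ k r q| <= \tr (A_ 0%N).
Proof.
apply: le_trans (iterate_trace_le0 k).
exact: sym_posdef_entry_le_trace (iterate_posdef k).
Qed.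

Lemma iterate_trace_gt0 k : 0 < \tr (A_ k).
Proof.
have hA := iterate_posdef k.
exact: lt_le_trans (sym_posdef_diag_gt0 ord0 hA)
  (sym_posdef_diag_le_trace ord0 hA).
Qed.

Lemma iterate_trace_cvg : cvgn (fun k => \tr (A_ k)).
Proof.
apply: nonincreasing_is_cvgn.
  by apply/nonincreasing_seqP => k; exact: iterate_trace_le.
by exists 0 => _ [k _ <-]; exact/ltW/iterate_trace_gt0.
Qed.

Lemma iterate_annihilates k i j : I k = (i, j) -> A_ k.+1 i j = 0.
Proof.
move=> Ik; have := J_jacobi_step_annihilates (pivot_neq k) (iterate_posdef k)
  (step k).
by rewrite -next Ik.
Qed.

Definition hyperbolic k := J4 (I k).1 (I k).1 != J4 (I k).2 (I k).2 :> R.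

Lemma trigonometric_pair k : ~~ hyperbolic k ->
  I k = (o0, o1) \/ I k = (o2, o3).
Proof.
rewrite negbK => /(same_sign_pair (strategy_lt hO k)).
by rewrite -surjective_pairing.
Qed.

Lemma trigonometric_step k i j : I k = (i, j) -> J4 i i == J4 j j :> R ->
  trig_step (A_ k) i j (F_ k).
Proof. by move=> Ik e; have := step k; rewrite /J_jacobi_step Ik /= e. Qed.

(** The bound of [hyp_step_drift] is at most the initial trace times a
    difference of consecutive terms of a convergent sequence. *)
Lemma hyperbolic_drift_cvg0 (eps : R) : 0 < eps -> exists N, forall k,
  (N <= k)%N -> hyperbolic k ->
  forall r q, `|A_ k.+1 r q - A_ k r q| <= eps.
Proof.
move=> e0; set T := \tr (A_ 0%N).
have T0 : 0 < T by exact: iterate_trace_gt0.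
pose D k := \tr (A_ k) - \tr (A_ k.+1).
have D0 : D @ \oo --> 0.
  rewrite -(subrr (limn (fun k => \tr (A_ k)))).
  apply: cvgB; first exact: iterate_trace_cvg.
  by rewrite (@cvg_shiftS _ (fun k => \tr (A_ k))); exact: iterate_trace_cvg.
have d0 : 0 < eps ^+ 2 / T by rewrite divr_gt0 ?exprn_gt0.
have /cvgr0Pnorm_lt/(_ _ d0)[N _ hN] := D0.
exists N => k /hN /= Dk hk r q.
rewrite -(@ler_pXn2r _ 2) ?nnegrE ?(ltW e0) // real_normK ?num_real //.
move: (step k); rewrite /J_jacobi_step (negbTE hk) => hF.
have := hyp_step_drift (pivot_neq k) (iterate_posdef k) hF r q.
rewrite -next -/(D k) => /le_trans -> //.
have Dk0 : 0 <= D k by rewrite subr_ge0 iterate_trace_le.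
apply: (@le_trans _ _ (T * D k)).
  by rewrite ler_wpM2r // iterate_trace_le0.
rewrite mulrC -ler_pdivlMr //; apply/ltW/(le_lt_trans _ Dk).
exact: ler_norm.
Qed.

Section OffDiagonal.
Variables (eps : R) (N : nat).
Hypothesis eps0 : 0 <= eps.
Hypothesis drift : forall k, (N <= k)%N -> hyperbolic k ->
  forall r q, `|A_ k.+1 r q - A_ k r q| <= eps.

Lemma hyperbolic_run_drift a d r q : (N <= a)%N ->
  (forall l, (l < d)%N -> hyperbolic (a + l)) ->
  `|A_ (a + d)%N r q - A_ a r q| <= d%:R * eps.
Proof.
move=> Na; elim: d => [|d IH] hyp; first by rewrite addn0 subrr normr0 mul0r.
rewrite addnS; have {}IH := IH (fun l hl => hyp l (ltnW hl)).
have := drift (leq_trans Na (leq_addr d a)) (hyp d (leqnn _)) r q => hd.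
rewrite (_ : _ - _ = (A_ (a + d).+1 r q - A_ (a + d)%N r q)
   + (A_ (a + d)%N r q - A_ a r q)); last by rewrite addrA subrK.
by apply: le_trans (ler_normD _ _) _; rewrite -natr1 mulrDl mul1r addrC lerD.
Qed.

Lemma diagonal_block_growth i j k : (i, j) = (o0, o1) \/ (i, j) = (o2, o3) ->
  (N <= k)%N -> `|A_ k.+1 i j| <= `|A_ k i j| + eps.
Proof.
move=> hij Nk; have [Ik|/eqP Ik] := eqVneq (I k) (i, j).
  by rewrite (iterate_annihilates Ik) normr0 addr_ge0.
have [hk|hk] := boolP (hyperbolic k).
  have := drift Nk hk i j.
  have := ler_normD (A_ k i j) (A_ k.+1 i j - A_ k i j).
  by rewrite addrC subrK; lra.
suff -> : A_ k.+1 i j = A_ k i j by rewrite lerDl.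
rewrite next; case: (trigonometric_pair hk) => Ik';
  case: hij Ik => [[-> ->]|[-> ->]] // _; rewrite ?Ik' //;
  by apply: (trig_step_fixed _ (trigonometric_step Ik' _));
    rewrite ?J4_diag_eq.
Qed.

(** In the preceding six steps the entry is annihilated once, and afterwards it
    moves by at most [eps] in each of at most five steps. *)
Lemma diagonal_block_small i j n : (i, j) = (o0, o1) \/ (i, j) = (o2, o3) ->
  (N + 6 <= n)%N -> `|A_ n i j| <= 6 * eps.
Proof.
move=> hij Nn.
have ij : (i < j)%N by case: hij => [[-> ->]|[-> ->]].
have [d d6 Ik] := strategy_hits hO (n - 6) ij.
have grow e : `|A_ (n - 6 + d + 1 + e)%N i j| <= e%:R * eps.
  elim: e => [|e IH].
    by rewrite addn0 addn1 (iterate_annihilates Ik) normr0 mul0r.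
  rewrite addnS; apply: le_trans (diagonal_block_growth hij _) _; first lia.
  by rewrite -natr1 mulrDl mul1r lerD2r.
have -> : n = (n - 6 + d + 1 + (5 - d))%N by lia.
apply: le_trans (grow _) _; apply: ler_wpM2r => //.
by rewrite ler_nat; lia.
Qed.


(** The heart of the argument.  Step [k] rotates the columns of the coupling
    block.  In the six steps from [k] on, let the entry be pivoted at offset [d]
    and the rows be rotated at offset [e].  If [d < e], the entry is annihilated
    after step [k] before the rows get mixed; otherwise it was annihilated one
    sweep earlier, after the previous rotation of the rows and before step [k].
    In both cases only hyperbolic steps lie in between. *)
Lemma coupling_entry_small k (i q : 'I_4) : I k = (o2, o3) -> (N + 6 <= k)%N ->
  (i < 2)%N -> (1 < q)%N -> `|A_ k i q| <= 6 * eps \/ `|A_ k.+1 i q| <= 6 * eps.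
Proof.
move=> Ik Nk i2 q2.
have [d d6 Id] := strategy_hits hO k (leq_trans i2 q2).
have [e e6 Ie] := strategy_hits hO k (isT : (o0 < o1)%N).
rewrite -/I in Id Ie.
have d0 : d <> 0%N.
  by move=> dE; move: Id i2; rewrite dE addn0 Ik => -[<-].
have e0 : e <> 0%N by move=> eE; move: Ie; rewrite eE addn0 Ik.
have de : d <> e.
  by move=> dE; move: Id q2; rewrite dE Ie => -[_ <-].
have hyp l : l <> k %[mod 6] -> l <> k + e %[mod 6] -> hyperbolic l.
  move=> lk le; have [//|/trigonometric_pair[Il|Il]] := boolP (hyperbolic l).
    by case: le; apply: (strategy_inj hO); rewrite -/I Il.
  by case: lk; apply: (strategy_inj hO); rewrite -/I Il.
have d6e : d%:R * eps <= 6 * eps by rewrite ler_wpM2r // ler_nat ltnW.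
have [lt_de|le_ed] := ltnP d e.
  right; apply: le_trans d6e.
  have := @hyperbolic_run_drift k.+1 d i q.
  rewrite addSn (iterate_annihilates Id) sub0r normrN; apply; first lia.
  by move=> l ld; apply: hyp; lia.
left; have It : I (k + d - 6) = (i, q).
  by rewrite -Id /I /cyclic_strategy; congr tnth; apply/val_inj => /=; lia.
have := @hyperbolic_run_drift (k + d - 6).+1 (5 - d) i q.
rewrite (iterate_annihilates It) subr0 (_ : (_.+1 + _)%N = k); last lia.
move=> drift'; apply: le_trans (drift' _ _) _; first lia.
  by move=> l ld; apply: hyp; lia.
by rewrite ler_wpM2r // ler_nat; lia.
Qed.

Lemma coupling_row_small k (i : 'I_4) : I k = (o2, o3) -> (N + 6 <= k)%N ->
  (i < 2)%N ->
  `|A_ k i o2| <= 24 * eps /\ `|A_ k i o3| <= 24 * eps.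
Proof.
move=> Ik Nk i2.
have hF : trig_step (A_ k) o2 o3 (F_ k).
  by apply: (trigonometric_step Ik); rewrite J4_diag_eq.
have [c [s [cs1 c0 sc rot]]] := trig_step_rotates (isT : o2 != o3) hF.
have ni : i != o2 /\ i != o3 by split; apply: contraTneq i2 => ->.
have [x' y'] := rot i ni.1 ni.2.
have := rotation_small cs1 c0 sc x' y' _ _; rewrite -next => /(_ (6 * eps)).
by rewrite mulrA -natrM; apply; exact: coupling_entry_small.
Qed.

(** A crude bound suffices, as it is iterated at most six times, from one
    rotation of the columns to the next. *)
Lemma coupling_growth k b : (N <= k)%N ->
  (forall i q : 'I_4, (i < 2)%N -> (1 < q)%N -> `|A_ k i q| <= b) ->
  forall i q : 'I_4, (i < 2)%N -> (1 < q)%N -> `|A_ k.+1 i q| <= 2 * b + eps.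
Proof.
move=> Nk hb i q i2 q2.
have b0 : 0 <= b by exact: le_trans (normr_ge0 _) (hb o0 o2 isT isT).
have [hk|hk] := boolP (hyperbolic k).
  have := drift Nk hk i q; have := hb i q i2 q2.
  have := ler_normD (A_ k i q) (A_ k.+1 i q - A_ k i q).
  by rewrite addrC subrK; lra.
have rotated (c s x y : R) : c ^+ 2 + s ^+ 2 = 1 -> `|x| <= b -> `|y| <= b ->
    `|x * c + y * s| <= 2 * b + eps.
  move=> cs1 xb yb.
  have c1 : `|c| <= 1 by rewrite ler_norml; apply/andP; split; nra.
  have s1 : `|s| <= 1 by rewrite ler_norml; apply/andP; split; nra.
  apply: le_trans (ler_normD _ _) _; rewrite !normrM.
  have : `|x| * `|c| <= b by rewrite (le_trans _ xb) // ler_piMr.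
  have : `|y| * `|s| <= b by rewrite (le_trans _ yb) // ler_piMr.
  by move: eps0; lra.
have hq : q = o2 \/ q = o3.
  by case: q q2 => [[|[|[|[|]]]]] // hq _; [left|right]; apply: val_inj.
have hi : i = o0 \/ i = o1.
  by case: i i2 => [[|[|[|[|]]]]] // hi _; [left|right]; apply: val_inj.
have hA := iterate_posdef k.
case: (trigonometric_pair hk) => Ik.
- have hF : trig_step (A_ k) o0 o1 (F_ k).
    by apply: (trigonometric_step Ik); rewrite J4_diag_eq.
  have [c [s [cs1 _ _ rot]]] := trig_step_rotates (isT : o0 != o1) hF.
  have [q0 q1] : q != o0 /\ q != o1 by split; apply: contraTneq q2 => ->.
  rewrite (sym_posdefC _ _ (iterate_posdef k.+1)) next.
  have [x' y'] := rot q q0 q1; case: hi => ->; rewrite ?x' ?y' -?mulrN.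
    by apply: rotated => //; rewrite (sym_posdefC _ _ hA) hb.
  apply: rotated; rewrite ?sqrrN //;
    by rewrite (sym_posdefC _ _ hA) hb.
- have hF : trig_step (A_ k) o2 o3 (F_ k).
    by apply: (trigonometric_step Ik); rewrite J4_diag_eq.
  have [c [s [cs1 _ _ rot]]] := trig_step_rotates (isT : o2 != o3) hF.
  have [i2' i3'] : i != o2 /\ i != o3 by split; apply: contraTneq i2 => ->.
  rewrite next; have [x' y'] := rot i i2' i3'; case: hq => ->; rewrite ?x' ?y'.
    by apply: rotated => //; rewrite hb.
  by rewrite -mulrN; apply: rotated; rewrite ?sqrrN // hb.
Qed.

(** The constant is [2 ^ 6 * 25]: six doublings of [24 * eps + eps]. *)
Lemma coupling_small n (i q : 'I_4) : (N + 12 <= n)%N ->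
  (i < 2)%N -> (1 < q)%N -> `|A_ n i q| <= 1600 * eps.
Proof.
move=> Nn.
have [d d6 Ik] := strategy_hits hO (n - 6) (isT : (o2 < o3)%N).
set k := (n - 6 + d)%N in Ik.
have Nk : (N + 6 <= k)%N by lia.
have start (i' q' : 'I_4) : (i' < 2)%N -> (1 < q')%N ->
  `|A_ k i' q'| <= 24 * eps.
  move=> i2 q2; have [x y] := coupling_row_small Ik Nk i2.
  have [->|->] // : q' = o2 \/ q' = o3.
  by case: q' q2 => [[|[|[|[|]]]]] // hq _; [left|right]; apply: val_inj.
(* The recursion [b -> 2 * b + eps] is linear in [b + eps]. *)
have grow e (i' q' : 'I_4) : (i' < 2)%N -> (1 < q')%N ->
    `|A_ (k + e)%N i' q'| <= 2 ^+ e * (25 * eps) - eps.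
  elim: e i' q' => [|e IH] i' q' i2 q2.
    rewrite addn0 expr0 mul1r; apply: le_trans (start _ _ i2 q2) _; lra.
  have Nke : (N <= k + e)%N by lia.
  rewrite addnS; apply: le_trans (coupling_growth Nke IH i2 q2) _.
  by rewrite exprS; lra.
move=> i2 q2; have -> : n = (k + (6 - d))%N by rewrite /k; lia.
apply: le_trans (grow _ _ _ i2 q2) _.
have : (2 : R) ^+ (6 - d) <= 2 ^+ 6 by rewrite ler_weXn2l ?ler1n ?leq_subr.
have -> : (2 : R) ^+ 6 = 64 by rewrite -natrX.
by have := eps0; nra.
Qed.

Lemma off_diagonal_small n r q : (N + 12 <= n)%N -> r != q ->
  `|A_ n r q| <= 1600 * eps.
Proof.
move=> Nn; wlog rq : r q / (r < q)%N => [hw|_].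
  rewrite neq_ltn => /orP[] rq; first by apply: hw; rewrite // neq_ltn rq.
  by rewrite (sym_posdefC _ _ (iterate_posdef n)); apply: hw;
    rewrite // neq_ltn rq.
have [rq2|rq2] := boolP ((r < 2)%N && (1 < q)%N).
  by have /andP[r2 q2] := rq2; exact: coupling_small.
have hrq : (r, q) = (o0, o1) \/ (r, q) = (o2, o3).
  apply: (@same_sign_pair R) => //; rewrite J4_diag_eq.
  by apply/eqP; lia.
apply: le_trans (diagonal_block_small hrq _) _; first lia.
by have := eps0; lra.
Qed.

End OffDiagonal.
Lemma off_diagonal_cvg0 r q : r != q -> (fun k => A_ k r q) @ \oo --> 0.
Proof.
move=> rq; apply/cvgr0Pnorm_le => e e0.
have K0 : 0 < 1600 :> R by rewrite ltr0n.
have e1 : 0 < e / 1600 := divr_gt0 e0 K0.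
have [N drift] := hyperbolic_drift_cvg0 e1.
exists (N + 12)%N => // n /= Nn.
apply: le_trans (off_diagonal_small (ltW e1) drift Nn rq) _.
by rewrite mulrC (divfK (lt0r_neq0 K0)).
Qed.

(** * The diagonal converges *)

(** The trace of the n-th power of J A is invariant, and it differs from the
    n-th power sum of the diagonal of J A by a term that vanishes together with
    the off-diagonal part. *)
Lemma diagonal_power_sum_cvg n :
  exists t : R, (fun k => \sum_i (J4 i i * A_ k i i) ^+ n) @ \oo --> t.
Proof.
pose M k := J4 *m A_ k.
have ME k i j : M k i j = J4 i i * A_ k i j.
  by rewrite /M {1}/J4 mul_diag_mx mxE; congr (_ * _); rewrite !mxE eqxx mulr1n.
have trM k : \tr (M k ^+ n) = \tr (M 0%N ^+ n).
  elim: k => // k <-; rewrite /M next.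
  exact: J_jacobi_step_spectrum (pivot_neq k) (iterate_posdef k) (step k) n.
clearbody M; pose D k := diag_mx (\row_i M k i i).
have MB k i j : `|M k i j| <= \tr (A_ 0%N).
  rewrite ME normrM J4E; case: ifP => _; rewrite ?normrN normr1 mul1r;
  exact: iterate_entry_le.
have bM : bounded_entries M by exists (\tr (A_ 0%N)).
have bD : bounded_entries D.
  exists (\tr (A_ 0%N)) => k i j; rewrite !mxE; case: eqP => _.
    by rewrite mulr1n; exact: MB.
  by rewrite mulr0n normr0; exact/ltW/iterate_trace_gt0.
have MD : vanishing_entries (fun k => M k - D k).
  move=> i j; have [->|ij] := eqVneq i j.
    under eq_fun do rewrite !mxE eqxx mulr1n subrr.
    exact: cvg_cst.
  have -> : (fun k => (M k - D k) i j) = (fun k => J4 i i * A_ k i j).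
    by apply/funext => k; rewrite -ME !mxE (negbTE ij) mulr0n subr0.
  by have := cvgMl_tmp (a := J4 i i) (off_diagonal_cvg0 ij); rewrite mulr0;
    exact.
exists (\tr (M 0%N ^+ n) - 0).
have -> : (fun k => \sum_i (J4 i i * A_ k i i) ^+ n) =
    (fun k => \tr (M 0%N ^+ n) - \tr (M k ^+ n - D k ^+ n)).
  apply/funext => k; rewrite linearB /= (trM k) opprB addrC subrK mxtrace_diagX.
  by apply: eq_bigr => i _; rewrite [in RHS]mxE ME.
apply: cvgB; first exact: cvg_cst.
exact: cvg_mxtrace0 (vanishing_entriesX n bM bD MD).
Qed.

Lemma gap_sign_persists i j (e : R) :
  (i, j) = (o0, o1) \/ (i, j) = (o2, o3) -> 0 < e ->
  \forall k \near \oo, - e <=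
    (A_ k i i - A_ k j j) * (A_ k.+1 i i - A_ k.+1 j j).
Proof.
move=> hij e0; have ij : i != j by case: hij => [[-> ->]|[-> ->]].
set T := \tr (A_ 0%N); have T0 : 0 < T by exact: iterate_trace_gt0.
pose u k := A_ k i i - A_ k j j.
have d0 : 0 < e / (4 * T) by rewrite divr_gt0 // mulr_gt0.
set d := e / (4 * T) in d0.
have dT : 2 * T * (2 * d) = e by rewrite /d; field; rewrite lt0r_neq0.
have uT k : `|u k| <= 2 * T.
  apply: le_trans (ler_normB _ _) _.
  by have := iterate_entry_le k i i; have := iterate_entry_le k j j;
    rewrite -/T; lra.
have [N1 drift] := hyperbolic_drift_cvg0 d0.
have [N2 _ small] := cvgr0_norm_lt _ (off_diagonal_cvg0 ij) _ d0.
exists (maxn N1 N2) => // k /=; rewrite geq_max => /andP[k1 k2].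
rewrite -/(u k) -/(u k.+1).
have [hk|hk] := boolP (hyperbolic k).
  have du : `|u k.+1 - u k| <= 2 * d.
    rewrite (_ : _ - _ = (A_ k.+1 i i - A_ k i i) - (A_ k.+1 j j - A_ k j j)).
      apply: le_trans (ler_normB _ _) _.
      by have := drift k k1 hk i i; have := drift k k1 hk j j; lra.
    by rewrite /u; ring.
  have -> : u k * u k.+1 = u k ^+ 2 + u k * (u k.+1 - u k) by ring.
  have : `|u k * (u k.+1 - u k)| <= e by rewrite normrM -dT ler_pM.
  by rewrite ler_norml => /andP[le_e _]; have := sqr_ge0 (u k); lra.
have own : I k = (i, j) -> - e <= u k * u k.+1.
  move=> Ik; have hF : trig_step (A_ k) i j (F_ k).
    apply: (trigonometric_step Ik); rewrite J4_diag_eq.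
    by case: hij => [[-> ->]|[-> ->]].
  have := trig_step_gap ij (iterate_posdef k) hF;
    rewrite -next -/(u k) -/(u k.+1).
  apply: le_trans; rewrite lerN2 -dT [leRHS]mulrC ler_pM ?mulr_ge0 //.
  by rewrite ler_wpM2l // ltW //; exact: small.
have other : u k.+1 = u k -> - e <= u k * u k.+1.
  by move=> ->; rewrite -expr2; have := sqr_ge0 (u k); lra.
case: (trigonometric_pair hk) => Ik; case: hij => E;
  try (by apply: own; rewrite E);
  apply: other; case: E => Ei Ej; rewrite /u Ei Ej next; congr (_ - _);
  by apply: (trig_step_fixed _ (trigonometric_step Ik _)); rewrite ?J4_diag_eq.
Qed.

(** The exponents 1, 2, 3 are needed: with the first two alone, only the sum of
    the two squared gaps would be controlled. *)
Lemma diagonal_cvg i : cvgn (fun k => A_ k i i).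
Proof.
have pos i' k : 0 < A_ k i' i' by exact: sym_posdef_diag_gt0 (iterate_posdef k).
have sum4 (f : 'I_4 -> R) : \sum_l f l = f o0 + f o1 + f o2 + f o3.
  rewrite !big_ord_recl big_ord0 addr0 !addrA.
  by congr (_ + _ + _ + _); congr f; apply: val_inj.
have cvg_sum4 n := diagonal_power_sum_cvg n.
have h0 : (fun k => A_ k o0 o0 + A_ k o1 o1 + A_ k o2 o2 + A_ k o3 o3) @ \oo
    --> limn (fun k => \tr (A_ k)).
  rewrite (_ : (fun k => _) = (fun k => \tr (A_ k)));
    first exact: iterate_trace_cvg.
  by apply/funext => k; rewrite /mxtrace sum4.
have [t1 h1] := cvg_sum4 1%N; have [t2 h2] := cvg_sum4 2%N.
have [t3 h3] := cvg_sum4 3%N.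
have {}h1 : (fun k => A_ k o0 o0 + A_ k o1 o1 - A_ k o2 o2 - A_ k o3 o3)
  @ \oo --> t1.
  rewrite (_ : (fun k => _) = (fun k => \sum_i (J4 i i * A_ k i i) ^+ 1)) //.
  by apply/funext => k; rewrite sum4 !J4E /=; ring.
have {}h2 : (fun k => A_ k o0 o0 ^+ 2 + A_ k o1 o1 ^+ 2 + A_ k o2 o2 ^+ 2
    + A_ k o3 o3 ^+ 2) @ \oo --> t2.
  rewrite (_ : (fun k => _) = (fun k => \sum_i (J4 i i * A_ k i i) ^+ 2)) //.
  by apply/funext => k; rewrite sum4 !J4E /=; ring.
have {}h3 : (fun k => A_ k o0 o0 ^+ 3 + A_ k o1 o1 ^+ 3 - A_ k o2 o2 ^+ 3
    - A_ k o3 o3 ^+ 3) @ \oo --> t3.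
  rewrite (_ : (fun k => _) = (fun k => \sum_i (J4 i i * A_ k i i) ^+ 3)) //.
  by apply/funext => k; rewrite sum4 !J4E /=; ring.
have [gap01 gap23] := cvg_gaps_of_power_sums (pos o0) (pos o1) (pos o2) (pos o3)
  h0 h1 h2 h3.
have {}gap01 := cvgn_of_sqr gap01
  (fun e => @gap_sign_persists o0 o1 e (or_introl erefl)).
have {}gap23 := cvgn_of_sqr gap23
  (fun e => @gap_sign_persists o2 o3 e (or_intror erefl)).
have half (f g s u : nat -> R) : cvgn s -> cvgn u ->
    (forall k, f k + g k = s k) -> (forall k, f k - g k = u k) ->
    cvgn f /\ cvgn g.
  move=> cs cu fs fu; split.
    rewrite (_ : f = fun k => (s k + u k) / 2).
      by apply: cvgP; apply: cvgMr_tmp; apply: cvgD; [exact: cs|exact: cu].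
    by apply/funext => k; rewrite -fs -fu; field.
  rewrite (_ : g = fun k => (s k - u k) / 2).
    by apply: cvgP; apply: cvgMr_tmp; apply: cvgB; [exact: cs|exact: cu].
  by apply/funext => k; rewrite -fs -fu; field.
have minus k : A_ k o0 o0 + A_ k o1 o1 - (A_ k o2 o2 + A_ k o3 o3)
  = A_ k o0 o0 + A_ k o1 o1 - A_ k o2 o2 - A_ k o3 o3 by ring.
have [s01 s23] := half (fun k => A_ k o0 o0 + A_ k o1 o1)
  (fun k => A_ k o2 o2 + A_ k o3 o3) _ _ (cvgP _ h0) (cvgP _ h1)
  (fun k => addrA _ _ _) minus.
have [c0 c1] := half (fun k => A_ k o0 o0) (fun k => A_ k o1 o1) _ _ s01 gap01
  (fun=> erefl) (fun=> erefl).
have [c2 c3] := half (fun k => A_ k o2 o2) (fun k => A_ k o3 o3) _ _ s23 gap23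
  (fun=> erefl) (fun=> erefl).
by case: i => [[|[|[|[|]]]] // hi]; rewrite (bool_irrelevance hi isT).
Qed.

Lemma iterate_cvg_diagonal : exists D : 'M[R]_4, is_diag_mx D /\ A_ @ \oo --> D.
Proof.
exists (diag_mx (\row_i limn (fun k => A_ k i i))); split.
  exact: diag_mx_is_diag.
apply: cvg_matrix_entrywise => i j; rewrite !mxE.
have [<-|ij] := eqVneq i j; first by rewrite mulr1n; exact: diagonal_cvg.
by rewrite mulr0n; exact: off_diagonal_cvg0.
Qed.

End Process.

Theorem corollary9 (R : realType) (O : 6.-tuple ('I_4 * 'I_4))
    (hO : is_ordering O) (A : 'M[R]_4) (hA : sym_posdef A)
    (A_ : nat -> 'M[R]_4)
    (hA_ : J_jacobi_sequence J4 (cyclic_strategy O) A A_) :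
  exists D : 'M[R]_4, is_diag_mx D /\ A_ @ \oo --> D.
Proof.
case: hA_ => A0 [F_ step]; apply: (@iterate_cvg_diagonal R O A_ F_ hO).
- by rewrite A0.
- by move=> k; exact: (step k).1.
- by move=> k; exact: (step k).2.
Qed.
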